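(* Let $\mathcal{A}$ be a Banach algebra such that $\mathrm{rad}(\mathcal{A})=\mathrm{rann}(\mathcal{A})$ and $\mathcal{A}/\mathrm{rad}(\mathcal{A})$ is commutative, and suppose $\mathcal{A}$ has a right identity. Let $(\delta,d)$ be a generalized derivation of $\mathcal{A}$ and $k\in\mathbb{N}$. Then the following are equivalent: (i) $\delta$ is $k$-commuting; (ii) $\delta$ is $k$-centralizing; (iii) $\delta$ is a right multiplier; (iv) there exists $b\in\mathcal{A}$ such that $\delta=R_b$.
   Context: $\mathrm{rad}(\mathcal{A})$ is the Jacobson radical and $\mathrm{rann}(\mathcal{A})=\{c\in\mathcal{A}: ac=0\ \forall a\in\mathcal{A}\}$. A derivation is a linear map $d$ with $d(ab)=d(a)b+ad(b)$; a generalized derivation $(\delta,d)$ is a linear $\delta$ with a derivation $d$ such that $\delta(ab)=a\delta(b)+d(a)b$. $Z(\mathcal{A})$ is the center, $[a,b]=ab-ba$; $T$ is $k$-centralizing (resp. $k$-commuting) if $[T(a),a^k]\in Z(\mathcal{A})$ (resp. $=0$) for all $a$. A right multiplier is a linear $T$ with $T(ab)=aT(b)$ for all $a,b$; $R_b(a)=ab$. *)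

(* Defs.v *)
From HB Require Import structures.
From mathcomp Require Import all_boot all_order all_algebra.
From mathcomp Require Import all_classical all_reals.
From mathcomp Require Import topology normedtype.
From mathcomp Require Import complex.
Set Implicit Arguments. Unset Strict Implicit. Unset Printing Implicit Defensive.
Import Order.TTheory GRing.Theory Num.Theory.
Import numFieldNormedType.Exports.
Local Open Scope ring_scope.

Section Banach.
Variables (R : realType).
Local Notation C := (R[i])%C.
Variable (V : completeNormedModType C).
Variable (mul : V -> V -> V).
Local Notation "a ** b" := (mul a b) (at level 40, left associativity).

Definition is_linear_map (f : V -> V) : Prop :=
  forall (l : C) (x y : V), f (l *: x + y) = l *: f x + f y.

Definition banach_algebra : Prop :=
  [/\ forall a b c, a ** (b ** c) = (a ** b) ** c,
      forall a, is_linear_map (mul a),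
      forall b, is_linear_map (fun a => a ** b) &
      forall a b, `|a ** b| <= `|a| * `|b| ].

(* Quasi-invertibility ((1-x)(1-y) = 1 = (1-y)(1-x) in the unitization). *)
Definition quasi_invertible (x : V) : Prop :=
  exists y : V, x + y - x ** y = 0 /\ x + y - y ** x = 0.

Definition jacobson_rad : set V :=
  [set a | forall b, quasi_invertible (b ** a)].

Definition rann : set V := [set c | forall a, a ** c = 0].

Definition quotient_by_rad_commutative : Prop :=
  forall a b, jacobson_rad (a ** b - b ** a).

Definition has_right_identity : Prop := exists e, forall a, a ** e = a.

Definition center : set V := [set z | forall a, z ** a = a ** z].

Definition commutator (a b : V) : V := a ** b - b ** a.

(* a^k for k >= 1: apow a k = a ** ... ** a (k factors); apow a 0 := a
   is an irrelevant default (only k >= 1 is used). *)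
Definition apow (a : V) (k : nat) : V := iter k.-1 (mul a) a.

Definition is_derivation (d : V -> V) : Prop :=
  is_linear_map d /\ forall a b, d (a ** b) = d a ** b + a ** d b.

Definition is_generalized_derivation (delta d : V -> V) : Prop :=
  [/\ is_linear_map delta, is_derivation d &
      forall a b, delta (a ** b) = a ** delta b + d a ** b].

Definition k_commuting (T : V -> V) (k : nat) : Prop :=
  forall a, commutator (T a) (apow a k) = 0.

Definition k_centralizing (T : V -> V) (k : nat) : Prop :=
  forall a, center (commutator (T a) (apow a k)).

Definition right_multiplier (T : V -> V) : Prop :=
  is_linear_map T /\ forall a b, T (a ** b) = a ** T b.

Definition Rmul (b : V) : V -> V := fun a => a ** b.

End Banach.

(* Main.v *)
(** Let [e] be a right identity. Since [A / rad A] is commutative and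
    [rad A = rann A], [x (a b) = x (b a)], and [B = e A] is a commutative
    semisimple Banach algebra isomorphic to [A / rad A]. From
    [delta a = a delta(e) + d a] everything reduces to [d = 0].

    First, [d A] lies in [rann A], i.e. the derivation [D = e d] vanishes
    (Johnson's theorem; [d] is not assumed continuous). The separating space
    [S] of [D] is a closed ideal, and a gliding hump argument yields [a] with
    [a S <> 0] such that [b a S] is zero or dense in [a S] for every [b] in [B].
    An element [f] of [a S] for which [1 - f] is not invertible is then an
    identity of [a S], and every nonzero element of [a S = f B] is invertible, so
    [f B = C f] by Gelfand-Mazur. As [D f = 0], this contradicts [f] in [S];
    hence [S = 0] and [D] is bounded. The Kleinecke-Shirokov argument,
    [ad(a)^n (E^n) = n! (- E a)^n] for [E = b D], makes [E a] quasinilpotent, so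
    [D a] is in the radical.

    Then [d(a) a^k = [delta a, a^k]] is central and in [rann A], hence zero;
    replacing [a] by [a + t e] with [t > |a|] makes right multiplication
    injective, and [d a = 0]. *)
Require Import Defs.
From HB Require Import structures.
From mathcomp Require Import all_boot all_order all_algebra.
From mathcomp Require Import all_classical all_reals.
From mathcomp Require Import topology normedtype derive.
From mathcomp Require Import complex ring lra.
Import Order.TTheory GRing.Theory Num.Theory.
Import numFieldNormedType.Exports.
Local Open Scope ring_scope.
Local Open Scope complex_scope.

Set Implicit Arguments.
Unset Strict Implicit.
Unset Printing Implicit Defensive.

(* A reflective decision procedure for equations in abelian groups. *)
Inductive zexpr := ZVar of nat | ZAdd of zexpr & zexpr | ZOpp of zexpr | ZZero.

Section ZmodReflection.
Variable G : zmodType.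

Fixpoint zden (env : seq G) (e : zexpr) : G :=
  match e with
  | ZVar i => env`_i
  | ZAdd e1 e2 => zden env e1 + zden env e2
  | ZOpp e1 => - zden env e1
  | ZZero => 0
  end.

Fixpoint zcoef (e : zexpr) (i : nat) : int :=
  match e with
  | ZVar j => (i == j)%:Z
  | ZAdd e1 e2 => zcoef e1 i + zcoef e2 i
  | ZOpp e1 => - zcoef e1 i
  | ZZero => 0
  end.

(** Normal form of an expression: an integer combination of its atoms. Indices past the end of [env]
    denote the default 0 and may be dropped. *)
Lemma zdenE env e : zden env e = \sum_(i < size env) env`_i *~ zcoef e i.
Proof.
elim: e => [j|e1 IH1 e2 IH2|e1 IH1|] /=.
- have [jn|nj] := ltnP j (size env).
    rewrite (bigD1 (Ordinal jn)) //= eqxx mulr1z big1 ?addr0 // => i.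
    by rewrite -val_eqE /= => /negPf->; rewrite mulr0z.
  rewrite nth_default // big1 // => i _.
  by rewrite ltn_eqF ?mulr0z // (leq_trans (ltn_ord i)).
- by rewrite IH1 IH2 -big_split; apply: eq_bigr => i _; rewrite mulrzDr.
- by rewrite IH1 -sumrN; apply: eq_bigr => i _; rewrite mulrNz.
- by rewrite big1 // => i _; rewrite mulr0z.
Qed.

Lemma zden_eq env e1 e2 :
  all (fun i => zcoef e1 i == zcoef e2 i) (iota 0 (size env)) ->
  zden env e1 = zden env e2.
Proof.
move=> /allP h; rewrite !zdenE; apply: eq_bigr => i _; congr (_ *~ _).
by apply/eqP/h; rewrite mem_iota ltn_ord.
Qed.

End ZmodReflection.

(** The nested [match constr:(tt)] runs the tactic [unify] inside an Ltac function that returns a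
    term; its failure selects the next branch. *)
Ltac zmem x l :=
  lazymatch l with
  | nil => constr:(false)
  | ?y :: ?l' =>
    match constr:(tt) with
    | _ => let _ := match constr:(tt) with _ => unify x y end in constr:(true)
    | _ => zmem x l'
    end
  end.

Ltac zindex x l :=
  lazymatch l with
  | ?y :: ?l' =>
    match constr:(tt) with
    | _ => let _ := match constr:(tt) with _ => unify x y end in constr:(O)
    | _ => let n := zindex x l' in constr:(S n)
    end
  end.

Ltac zatoms t l :=
  lazymatch t with
  | (?a + ?b)%R => let l' := zatoms a l in zatoms b l'
  | (- ?a)%R => zatoms a l
  | 0%R => l
  | _ => let m := zmem t l in
    lazymatch m with true => l | false => constr:(cons t l) end
  end.

Ltac zreify t l :=
  lazymatch t with
  | (?a + ?b)%R =>
    let e1 := zreify a l in let e2 := zreify b l in constr:(ZAdd e1 e2)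
  | (- ?a)%R => let e := zreify a l in constr:(ZOpp e)
  | 0%R => constr:(ZZero)
  | _ => let n := zindex t l in constr:(ZVar n)
  end.

Ltac zmod :=
  lazymatch goal with
  | |- @eq ?G ?a ?b =>
    let l0 := zatoms a (@nil G) in let l := zatoms b l0 in
    let e1 := zreify a l in let e2 := zreify b l in
    exact: (@zden_eq _ l e1 e2 erefl)
  end.

(** * Real-valued norm and limits of sequences with controlled increments *)

Section RealNorm.
Variables (R : realType) (V : completeNormedModType R[i]).
Implicit Types (x y z : V) (l : R[i]).

(** The norm of [V] takes values in [R[i]]; its real part, which loses nothing by [nrmE], allows
    real linear arithmetic. *)
Definition nrm x : R := complex.Re `|x|.

Lemma nrmE x : `|x| = (nrm x)%:C.
Proof. by rewrite /nrm RRe_real // ger0_real. Qed.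

Lemma nrm_ge0 x : 0 <= nrm x.
Proof. by rewrite -ler0c -nrmE. Qed.

Lemma nrm0 : nrm (0 : V) = 0.
Proof. by rewrite /nrm normr0. Qed.

Lemma nrm_eq0 x : nrm x = 0 -> x = 0.
Proof. by move=> h; apply/normr0_eq0; rewrite nrmE h. Qed.

Lemma nrm_gt0 x : x <> 0 -> 0 < nrm x.
Proof.
by move=> x0; rewrite lt_neqAle nrm_ge0 andbT; apply/eqP => /esym/nrm_eq0.
Qed.

Lemma nrmD x y : nrm (x + y) <= nrm x + nrm y.
Proof. by rewrite -lecR rmorphD /= -!nrmE ler_normD. Qed.

Lemma nrmN x : nrm (- x) = nrm x.
Proof. by rewrite /nrm normrN. Qed.

Lemma nrmBC x y : nrm (x - y) = nrm (y - x).
Proof. by rewrite -nrmN opprB. Qed.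

Lemma nrmB x y : nrm (x - y) <= nrm x + nrm y.
Proof. by rewrite -(nrmN y) nrmD. Qed.

Lemma nrm_trans y x z : nrm (x - z) <= nrm (x - y) + nrm (y - z).
Proof. by rewrite (le_trans _ (nrmD _ _)) // addrA subrK. Qed.

Lemma nrm_le_dist y x : nrm x <= nrm y + nrm (x - y).
Proof. by rewrite (le_trans _ (nrmD _ _)) // addrC subrK. Qed.

Lemma nrmZ l x : nrm (l *: x) = complex.Re `|l| * nrm x.
Proof.
by apply: complexI; rewrite rmorphM /= -!nrmE normrZ.
Qed.

Lemma nrmZr (t : R) x : nrm (t%:C *: x) = `|t| * nrm x.
Proof. by rewrite nrmZ normc_def /= expr0n addr0 sqrtr_sqr. Qed.

Lemma nrm_small x : (forall eps, 0 < eps -> nrm x <= eps) -> x = 0.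
Proof.
move=> h; apply: nrm_eq0; apply/eqP; rewrite eq_le nrm_ge0 andbT.
by apply/ler_addgt0Pr => e /h; rewrite add0r.
Qed.

Lemma pow_half_small (K eps : R) : 0 < eps -> exists n, K / 2 ^+ n < eps.
Proof.
move=> e0; have K0 : 0 <= `|K| / eps by rewrite divr_ge0 ?normr_ge0 ?(ltW e0).
exists (Num.bound (`|K| / eps)); set n := Num.bound _.
have hn : `|K| / eps < n%:R := archi_boundP K0.
rewrite ltr_pdivrMr ?exprn_gt0 // (le_lt_trans (ler_norm _)) //.
rewrite mulrC -ltr_pdivrMr // (lt_le_trans hn) // -natrX ler_nat.
by rewrite ltnW // ltn_expl.
Qed.

Lemma nrm_tail (u : nat -> V) (r : nat -> R) n m :
  (forall k, nrm (u k.+1 - u k) + r k.+1 <= r k) -> (forall k, 0 <= r k) ->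
  nrm (u (m + n)%N - u n) <= r n.
Proof.
(* The invariant keeps the remaining radius, so each induction step is one triangle inequality. *)
move=> h r0; suff: nrm (u (m + n)%N - u n) + r (m + n)%N <= r n.
  by apply: le_trans; rewrite lerDl.
elim: m => [|m IH]; first by rewrite add0n subrr nrm0 add0r.
rewrite addSn; have := h (m + n)%N; have := nrm_trans (u (m + n)%N) (u (m + n).+1) (u n).
by move: IH; lra.
Qed.

(* The radii [r] bound the tails, as in a nested sequence of closed balls. *)
Lemma nested_balls_cvg (u : nat -> V) (r : nat -> R) :
  (forall k, nrm (u k.+1 - u k) + r k.+1 <= r k) -> (forall k, 0 <= r k) ->
  (forall eps, 0 < eps -> exists n, r n < eps) ->
  exists x, forall n, nrm (x - u n) <= r n.
Proof.
move=> h r0 rs.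
have : cvg (u @ \oo)%classic.
  apply: cauchy_cvg; apply: cauchy_exP => e e0.
  have eR : e = (complex.Re e)%:C by rewrite RRe_real // ger0_real // ltW.
  have [|n hn] := rs (complex.Re e); first by rewrite -ltcR -eR.
  exists (u n); exists n => // k /= nk; rewrite /fmapE -ball_normE /=.
  rewrite nrmE eR ltcR nrmBC -(subnK nk).
  by apply: le_lt_trans hn; apply: nrm_tail.
move=> /cvg_ex[/= x hx]; exists x => n; apply/ler_addgt0Pr => e e0.
have /cvgrPdist_lt/(_ e%:C) := hx; rewrite ltcR => /(_ e0)[N _ hN].
have := hN (N + n)%N (leq_addr _ _); rewrite /= nrmE ltcR => hxN.
have := nrm_tail n N h r0; have := nrm_trans (u (N + n)%N) x (u n); lra.
Qed.

Lemma geometric_cvg (u : nat -> V) (K : R) :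
  (forall k, nrm (u k.+1 - u k) <= K / 2 ^+ k) ->
  exists x, forall n, nrm (x - u n) <= 2 * K / 2 ^+ n.
Proof.
move=> h; have K0 : 0 <= K.
  by have := h 0%N; rewrite expr0 divr1; apply: le_trans; apply: nrm_ge0.
have p0 k : (0 : R) < 2 ^+ k by rewrite exprn_gt0.
apply: nested_balls_cvg => [k|k|eps e0].
- have := h k; rewrite exprS invfM; set t := _^-1; lra.
- by rewrite divr_ge0 // ?mulr_ge0 // ltW.
- exact: pow_half_small.
Qed.

End RealNorm.

(** Past [N >= 2 L] every new factor of the factorial is at least [2 L], so [L ^ n / n!] at least
    halves at each step. *)
Lemma factorial_dominates (R : realType) (L A : R) : 0 <= L -> 0 <= A ->
  exists n, 2 * (L ^+ n.+1 * A) <= n.+1`!%:R.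
Proof.
move=> L0 A0; pose N := Num.bound (2 * L).
have hN : 2 * L <= N.+1%:R.
  have : 2 * L < N%:R by apply: archi_boundP; rewrite mulr_ge0.
  by move=> /ltW/le_trans; apply; rewrite ler_nat.
have grow m : L ^+ (N.+1 + m) * 2 ^+ m <= (N.+1 + m)`!%:R * L ^+ N.+1.
  elim: m => [|m IH]; first by rewrite addn0 expr0 mulr1 ler_peMl ?exprn_ge0 // ler1n fact_gt0.
  rewrite addnS factS natrM.
  have -> : L ^+ (N.+1 + m).+1 * 2 ^+ m.+1 = (2 * L) * (L ^+ (N.+1 + m) * 2 ^+ m).
    by rewrite [L ^+ (_.+1)]exprS [2 ^+ (_.+1)]exprS; ring.
  rewrite -[leRHS]mulrA; apply: ler_pM => //; first by rewrite mulr_ge0.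
    by apply: mulr_ge0; apply: exprn_ge0.
  by apply: le_trans hN _; rewrite ler_nat addSn ltnS leqW // leq_addr.
have [m hm] := pow_half_small (2 * A * L ^+ N.+1) (ltr01 : 0 < 1 :> R).
exists (N + m)%N; rewrite -addSn.
have p0 : (0 : R) < 2 ^+ m by rewrite exprn_gt0.
move: hm; rewrite ltr_pdivrMr // mul1r => /ltW hm.
rewrite -(ler_pM2r p0).
have := ler_wpM2l A0 (grow m) => h1.
have := ler_wpM2l (ler0n R (N.+1 + m)`!) hm => h2.
apply: le_trans h2; move: h1.
move: (L ^+ (N.+1 + m)) (L ^+ N.+1) (_`!%:R : R) (2 ^+ m : R) => x y z t h.
lra.
Qed.

(** * Baire category and the closed graph theorem modulo the separating space *)

Section ClosedGraph.
Variables (R : realType) (V : completeNormedModType R[i]).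
Implicit Types (x y z : V).

(** Density in a ball stands for a closure with interior. If no [E m] is dense in a ball, one builds
    nested balls, the one chosen at stage [m] staying away from [E m]; their common point
    contradicts the covering. *)
Lemma baire_category (E : nat -> V -> Prop) : (forall x, exists m, E m x) ->
  exists m x0 (r : R), 0 < r /\ forall x, nrm (x - x0) < r ->
    forall eps : R, 0 < eps -> exists2 y, E m y & nrm (x - y) < eps.
Proof.
move=> Ecov; apply: contrapT => noball.
have step : forall p : nat * (V * R), exists q : V * R, 0 < p.2.2 ->
    [/\ 0 < q.2, nrm (q.1 - p.2.1) + q.2 <= p.2.2, q.2 <= p.2.2 / 2 &
        forall y, E p.1 y -> q.2 < nrm (q.1 - y)].
  move=> [m [x0 r]] /=; have [r0|] := pselect (0 < r); last by exists (x0, r).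
  apply: contrapT => noq; apply: noball; exists m, x0, (r / 2).
  split=> [|x xx0 eps e0]; first by rewrite divr_gt0.
  apply: contrapT => noy; apply: noq; exists (x, Num.min (eps / 2) (r / 2)) => /= _.
  have le1 : Num.min (eps / 2) (r / 2) <= r / 2 by rewrite ge_min lexx orbT.
  have le2 : Num.min (eps / 2) (r / 2) <= eps / 2 by rewrite ge_min lexx.
  split=> //; first by rewrite lt_min !divr_gt0.
    by move: le1; set t := Num.min _ _; lra.
  move=> y Ey; have [//|xy] := ltP; case: noy; exists y => //.
  by move: le2 xy; set t := Num.min _ _; lra.
have [f hf] := choice step.
pose s := fix s k := if k is k'.+1 then f (k', s k') else ((0 : V), (1 : R)).
have s0 k : 0 < (s k).2.
  by elim: k => [|k IH] /=; [rewrite ltr01|have [] := hf (k, s k) IH].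
have sP k := hf (k, s k) (s0 k).
have rk k : (s k).2 <= 1 / 2 ^+ k.
  elim: k => [|k IH] /=; first by rewrite expr0 divr1.
  by have [_ _ + _] := sP k; move: IH; rewrite exprS invfM; set p := _^-1; lra.
have [|||x hx] := @nested_balls_cvg _ _ (fun k => (s k).1) (fun k => (s k).2).
- by move=> k; have [] := sP k.
- by move=> k; apply: ltW.
- move=> eps /(pow_half_small 1)[n hn]; exists n; exact: le_lt_trans hn.
have [m Em] := Ecov x; have [_ _ _ /(_ _ Em)] := sP m.
by rewrite ltNge nrmBC (hx m.+1).
Qed.

Variable T : V -> V.
Hypothesis Tlin : is_linear_map T.

Lemma lin0 : T 0 = 0.
Proof. by have := Tlin (-1) 0 0; rewrite scaler0 addr0 scaleN1r addNr. Qed.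

Lemma linD x y : T (x + y) = T x + T y.
Proof. by have := Tlin 1 x y; rewrite !scale1r. Qed.

Lemma linZ l x : T (l *: x) = l *: T x.
Proof. by have := Tlin l x 0; rewrite lin0 !addr0. Qed.

Lemma linN x : T (- x) = - T x.
Proof. by rewrite -scaleN1r linZ scaleN1r. Qed.

Lemma linB x y : T (x - y) = T x - T y.
Proof. by rewrite linD linN. Qed.

(** The limits of [T x_n] along sequences [x_n] tending to 0. *)
Definition separating_space : set V :=
  [set y | forall eps : R, 0 < eps -> exists x, nrm x < eps /\ nrm (T x - y) < eps].

Local Notation S := separating_space.

Lemma sep0 : S 0.
Proof. by move=> e e0; exists 0; rewrite lin0 subrr nrm0. Qed.

Lemma sepD x y : S x -> S y -> S (x + y).
Proof.
move=> Sx Sy e e0; have e2 : 0 < e / 2 by rewrite divr_gt0.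
have [[x' [hx Tx]] [y' [hy Ty]]] := (Sx _ e2, Sy _ e2).
exists (x' + y'); rewrite linD opprD addrACA; split.
  by have := nrmD x' y'; lra.
by have := nrmD (T x' - x) (T y' - y); lra.
Qed.

Lemma sepZ l x : S x -> S (l *: x).
Proof.
move=> Sx e e0; set c := complex.Re `|l|.
have c0 : 0 <= c by rewrite /c -ler0c RRe_real ?ger0_real.
have e2 : 0 < e / (c + 1) by rewrite divr_gt0 // ltr_wpDl.
have small z : nrm z < e / (c + 1) -> nrm (l *: z) < e.
  rewrite nrmZ -/c ltr_pdivlMr ?ltr_wpDl // mulrDr mulr1 mulrC.
  by have := nrm_ge0 z; lra.
have [x' [hx Tx]] := Sx _ e2.
by exists (l *: x'); rewrite linZ -scalerBr; split; apply: small.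
Qed.

Lemma sepN x : S x -> S (- x).
Proof. by rewrite -scaleN1r; apply: sepZ. Qed.

Lemma sepB x y : S x -> S y -> S (x - y).
Proof. by move=> Sx /sepN; apply: sepD. Qed.

(* Baire applied to the sets [dist (T x, S) <= m], then successive approximation
   as in the closed graph theorem. *)
Lemma closed_graph_mod_sep :
  exists2 C : R, 0 <= C & forall x, exists2 s, S s & nrm (T x - s) <= C * nrm x.
Proof.
pose E m x := exists2 s, S s & nrm (T x - s) <= m%:R.
have [|m [x0 [r [r0 dense]]]] := @baire_category E.
  move=> x; exists (Num.bound (nrm (T x))); exists 0; first exact: sep0.
  by rewrite subr0 ltW // archi_boundP // nrm_ge0.
have rS := divr_gt0 r0 (ltr0Sn R 1).
pose K : R := 4 * m%:R / r.
have K0 : 0 <= K by rewrite divr_ge0 ?(ltW r0) ?mulr_ge0.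
(* Density near [x0] is moved to the origin: approximate [x0 + t x] and [x0] in the ball, subtract,
   and divide by [t]. *)
have approx x (eps : R) : 0 < eps -> exists y s,
    [/\ nrm (x - y) <= eps, S s & nrm (T y - s) <= K * nrm x].
  move=> e0; have [->|/nrm_gt0 x_gt0] := pselect (x = 0).
    exists 0, 0; rewrite !subr0 lin0 nrm0 mulr0 ltW //; split=> //; exact: sep0.
  pose t := r / 2 / nrm x; have t0 : 0 < t by rewrite divr_gt0.
  have et0 : 0 < t * eps / 2 by rewrite divr_gt0 // mulr_gt0.
  have [|y1 [s1 Ss1 hs1] hy1] := dense (x0 + t%:C *: x) _ _ et0.
    have -> : x0 + t%:C *: x - x0 = t%:C *: x by zmod.
    rewrite nrmZr gtr0_norm // /t divfK ?gt_eqF //; lra.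
  have [|y2 [s2 Ss2 hs2] hy2] := dense x0 _ _ et0; first by rewrite subrr nrm0.
  exists (t^-1%:C *: (y1 - y2)), (t^-1%:C *: (s1 - s2)); split.
  - have -> : x - t^-1%:C *: (y1 - y2) =
        t^-1%:C *: ((x0 + t%:C *: x - y1) - (x0 - y2)).
      have -> : x0 + t%:C *: x - y1 - (x0 - y2) = t%:C *: x - (y1 - y2) by zmod.
      by rewrite [RHS]scalerBr scalerA -rmorphM /= mulVf ?gt_eqF // scale1r.
    rewrite nrmZr gtr0_norm ?invr_gt0 // mulrC ler_pdivrMr // [eps * t]mulrC.
    by have := nrmB (x0 + t%:C *: x - y1) (x0 - y2); lra.
  - by apply/sepZ/sepB.
  - rewrite linZ -scalerBr nrmZr gtr0_norm ?invr_gt0 // linB.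
    have -> : T y1 - T y2 - (s1 - s2) = (T y1 - s1) - (T y2 - s2) by zmod.
    have -> : K * nrm x = t^-1 * (2 * m%:R).
      by rewrite /K /t; field; rewrite !gt_eqF.
    rewrite ler_pM2l ?invr_gt0 //.
    by have := nrmB (T y1 - s1) (T y2 - s2); lra.
exists (2 * K) => [|x]; first by rewrite mulr_ge0.
have [->|/nrm_gt0 x_gt0] := pselect (x = 0).
  by exists 0; [exact: sep0|rewrite lin0 subr0 nrm0 mulr0].
have step : forall p : nat * V, exists q : V * V,
    [/\ nrm (p.2 - q.1) <= nrm x / 2 ^+ p.1.+1, S q.2 &
        nrm (T q.1 - q.2) <= K * nrm p.2].
  move=> [n z] /=.
  have [|y [s ?]] := approx z (nrm x / 2 ^+ n.+1); last by exists (y, s).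
  by rewrite divr_gt0 // exprn_gt0.
have [f hf] := choice step.
pose z := fix z k := if k is k'.+1 then z k' - (f (k', z k')).1 else x.
have zP k : nrm (z k) <= nrm x / 2 ^+ k.
  by case: k => [|k] /=; [rewrite expr0 divr1|have [] := hf (k, z k)].
(* [z] is the remainder of [x]; [T x - T (z k)] splits into [U k], a convergent sum, and [W k],
   which lies in [S]. *)
pose v k := T (f (k, z k)).1 - (f (k, z k)).2.
pose U := fix U k := if k is k'.+1 then U k' + v k' else 0.
pose W := fix W k := if k is k'.+1 then W k' + (f (k', z k')).2 else 0.
have SW k : S (W k).
  elim: k => [|k IH] /=; first exact: sep0.
  by apply: sepD => //; have [] := hf (k, z k).
have TE k : T (z k) = T x - U k - W k.
  elim: k => [|k IH] /=; first by rewrite !subr0.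
  by rewrite linB IH /v; zmod.
have [|w hw] := @geometric_cvg _ _ U (K * nrm x).
  move=> k /=; rewrite addrAC subrr add0r.
  have [_ _ /le_trans-> //] := hf (k, z k).
  by rewrite -mulrA; apply: ler_wpM2l; [exact: K0|exact: zP].
exists (T x - w); last first.
  have := hw 0%N; rewrite /= subr0 expr0 divr1 opprB addrC subrK; lra.
move=> e e0; have e4 : 0 < e / 4 by rewrite divr_gt0.
have [n] := pow_half_small ((2 * K + 1) * nrm x) e4.
have /mulr_ge0 p0 : 0 <= (2 ^+ n : R)^-1 by rewrite invr_ge0 exprn_ge0.
rewrite mulrDl mul1r mulrDl => hn.
have := p0 _ (ltW x_gt0); rewrite mulrC => hx0.
have := p0 _ (mulr_ge0 (mulr_ge0 (ler0n R 2) K0) (ltW x_gt0)); rewrite mulrC => hKx0.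
(* As [W n + T (z n) = T x - U n], the small vector [x' + z n] is sent close to [T x - w]. *)
have [x' [hx' Tx']] := SW n _ e4.
exists (x' + z n); split; first by have := nrmD x' (z n); have := zP n; lra.
have -> : T (x' + z n) - (T x - w) = (T x' - W n) + (w - U n).
  by rewrite linD TE; zmod.
have := nrmD (T x' - W n) (w - U n); have := hw n; rewrite mulrA; lra.
Qed.

End ClosedGraph.

(** * Banach algebra calculus and quasi-inverses *)

Section BanachAlgebra.
Variables (R : realType) (V : completeNormedModType R[i]) (mul : V -> V -> V).
Hypothesis bA : banach_algebra mul.
Local Notation "a ** b" := (mul a b) (at level 40, left associativity).
Implicit Types (a b c x y z : V).

Lemma mulA a b c : a ** (b ** c) = a ** b ** c.
Proof. by case: bA => h _ _ _; apply: h. Qed.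

Lemma mul_lin a : is_linear_map (mul a).
Proof. by case: bA => _ h _ _; apply: h. Qed.

Lemma mulr_lin b : is_linear_map (fun a => a ** b).
Proof. by case: bA => _ _ h _; apply: h. Qed.

Lemma mul0 a : a ** 0 = 0. Proof. exact: lin0 (mul_lin a). Qed.
Lemma mul0l b : 0 ** b = 0. Proof. exact: lin0 (mulr_lin b). Qed.
Lemma mulD a x y : a ** (x + y) = a ** x + a ** y.
Proof. exact: linD (mul_lin a) x y. Qed.
Lemma mulDl b x y : (x + y) ** b = x ** b + y ** b.
Proof. exact: linD (mulr_lin b) x y. Qed.
Lemma mulN a x : a ** (- x) = - (a ** x). Proof. exact: linN (mul_lin a) x. Qed.
Lemma mulNl b x : (- x) ** b = - (x ** b). Proof. exact: linN (mulr_lin b) x. Qed.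
Lemma mulZ a l x : a ** (l *: x) = l *: (a ** x).
Proof. exact: linZ (mul_lin a) l x. Qed.
Lemma mulZl b l x : (l *: x) ** b = l *: (x ** b).
Proof. exact: linZ (mulr_lin b) l x. Qed.

Definition mulBE := (mulD, mulDl, mulN, mulNl).

Lemma nrmM a b : nrm (a ** b) <= nrm a * nrm b.
Proof.
by case: bA => _ _ _ h; rewrite -lecR rmorphM /= -!nrmE; apply: h.
Qed.

Lemma nrmM_le (A B : R) a b : nrm a <= A -> nrm b <= B -> nrm (a ** b) <= A * B.
Proof. by move=> ha hb; apply: le_trans (nrmM a b) _; rewrite ler_pM ?nrm_ge0. Qed.

Lemma nrm_pow_small x (K : R) : (forall n, nrm x <= K / 2 ^+ n) -> x = 0.
Proof.
move=> h; apply: nrm_small => eps /(pow_half_small K)[n hn].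
exact: le_trans (h n) (ltW hn).
Qed.

(** Neumann series: [s k] is [- (r + ... + r ^ k)]. Its limit solves [y = r y - r] and commutes with
    [r]. *)
Lemma quasi_invertible_small r : nrm r <= 1 / 2 -> quasi_invertible mul r.
Proof.
move=> hr; pose s := fix s k := if k is k'.+1 then r ** s k' - r else 0.
have [|y hy] := @geometric_cvg _ _ s (1 / 2).
  elim=> [|k IH]; first by rewrite /= mul0 sub0r subr0 nrmN expr0 divr1.
  have -> : s k.+2 - s k.+1 = r ** (s k.+1 - s k) by rewrite /= !mulBE; zmod.
  by apply: le_trans (nrmM_le hr IH) _; rewrite exprS invfM; lra.
have yE : y = r ** y - r.
  apply/eqP; rewrite -subr_eq0; apply/eqP.
  apply: (@nrm_pow_small _ 1) => n.
  have -> : y - (r ** y - r) = (y - s n.+1) - r ** (y - s n).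
    by rewrite /= !mulBE; zmod.
  have := nrmB (y - s n.+1) (r ** (y - s n)); have := hy n.+1.
  by have := nrmM_le hr (hy n); rewrite exprS invfM; lra.
have com n : r ** s n = s n ** r.
  elim: n => [|n IH] /=; first by rewrite mul0 mul0l.
  by rewrite !mulBE -mulA -IH.
have yC : r ** y = y ** r.
  apply/eqP; rewrite -subr_eq0; apply/eqP.
  apply: (@nrm_pow_small _ 1) => n.
  have -> : r ** y - y ** r = r ** (y - s n) - (y - s n) ** r.
    by rewrite !mulBE com; zmod.
  have := nrmB (r ** (y - s n)) ((y - s n) ** r).
  by have := nrmM_le hr (hy n); have := nrmM_le (hy n) hr; lra.
by exists y; rewrite -yC; split; rewrite [in X in _ + X - _]yE; zmod.
Qed.

(** * The Gelfand-Mazur theorem by a maximum principle *)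

Section GelfandMazur.
(** Here [f] plays the identity and [g] the resolvent of [z], assumed to exist at every complex
    number; this is refuted. *)
Variables (f z : V) (g : R[i] -> V).
Hypotheses (f0 : f <> 0) (fz : f ** z = z) (zf : z ** f = z).
Hypotheses (fg : forall l, f ** g l = g l) (gf : forall l, g l ** f = g l).
Hypothesis zg : forall l, (z - l *: f) ** g l = f.
Hypothesis gz : forall l, g l ** (z - l *: f) = f.

Lemma resolvent_eq l m : g m - g l = (m - l) *: (g m ** g l).
Proof.
have -> : g m - g l = g m ** ((z - l *: f) ** g l) - g m ** (z - m *: f) ** g l.
  by rewrite zg gf gz fg.
rewrite !(mulBE, mulZ, mulZl) !mulA gf scalerBl.
by zmod.
Qed.

Local Notation u l := (nrm (g l)).
Local Notation cabs l := (complex.Re `|l : R[i]|).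

(** Norms are taken in [l g(l) = g(l) z - f]; this makes [u l] small for large [l]. *)
Lemma resolvent_decay l : u l * cabs l <= u l * nrm z + nrm f.
Proof.
have h : g l ** z - l *: g l = f by rewrite -[RHS](gz l) mulD mulN mulZ gf.
rewrite mulrC -nrmZ -nrmN.
have -> : - (l *: g l) = f - g l ** z by rewrite -h; zmod.
have := nrmB f (g l ** z); have := nrmM (g l) z; lra.
Qed.

Lemma cabs_ge0 l : 0 <= cabs l.
Proof. by rewrite -ler0c RRe_real ?ger0_real. Qed.

Lemma cabsE l : cabs l = Num.sqrt (complex.Re l ^+ 2 + complex.Im l ^+ 2).
Proof. by rewrite normc_def. Qed.

Lemma cabs_ge_Re l : `|complex.Re l| <= cabs l.
Proof. by rewrite cabsE -sqrtr_sqr ler_wsqrtr // lerDl sqr_ge0. Qed.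

Lemma cabs_ge_Im l : `|complex.Im l| <= cabs l.
Proof. by rewrite cabsE -sqrtr_sqr ler_wsqrtr // lerDr sqr_ge0. Qed.

Lemma cabs_le_ReIm l : cabs l <= `|complex.Re l| + `|complex.Im l|.
Proof.
rewrite cabsE -[leRHS]ger0_norm ?addr_ge0 // -sqrtr_sqr ler_wsqrtr //.
rewrite -(real_normK (num_real (complex.Re l))) -(real_normK (num_real (complex.Im l))).
by rewrite sqrrD lerD2r lerDl mulrn_wge0 // mulr_ge0.
Qed.

Lemma resolvent_gt0 l : 0 < u l.
Proof.
apply: nrm_gt0 => gl0; apply: f0; by rewrite -(zg l) gl0 mul0.
Qed.

(* The mean over the four points [p + w s], [w ^+ 4 = 1], cancels the first
   three orders of the resolvent expansion. *)
Lemma resolvent_mean (p : R[i]) (s : R) :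
  4 * u p <= (u (p + s%:C) + u (p - s%:C) + u (p + 'i * s%:C) + u (p - 'i * s%:C))
             * (1 + s ^+ 4 * u p ^+ 4).
Proof.
set G := g p; pose Q x := x ** G.
have QE (c : R[i]) : g (p + c) = G + c *: Q (g (p + c)).
  by have := resolvent_eq p (p + c); rewrite [p + c]addrC addrK => <-; rewrite subrKC.
have QD x y : Q (x + y) = Q x + Q y by rewrite /Q mulDl.
have QZ (c : R[i]) x : Q (c *: x) = c *: Q x by rewrite /Q mulZl.
have QE4 (c : R[i]) : g (p + c) = G + c *: Q G + c ^+ 2 *: Q (Q G) + c ^+ 3 *: Q (Q (Q G))
     + c ^+ 4 *: Q (Q (Q (Q (g (p + c))))).
  set h := g (p + c); have E : h = G + c *: Q h := QE c.
  rewrite {1}E {1}E {1}E {1}E !(QD, QZ, scalerDr, scalerA).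
  by rewrite !exprS expr0 !mulr1 !mulrA !addrA.
pose c1 : R[i] := s%:C; pose c2 : R[i] := 'i * s%:C.
pose H := g (p + c1) + g (p - c1) + g (p + c2) + g (p - c2).
have HE : H = 4%:R *: G + (c1 ^+ 4) *: Q (Q (Q (Q H))).
  have c2_2 : c2 ^+ 2 = - c1 ^+ 2 by rewrite /c2 exprMn sqr_i mulN1r.
  have c2_3 : c2 ^+ 3 = - (c1 ^+ 2 * c2) by rewrite exprSr c2_2 mulNr.
  have c2_4 : c2 ^+ 4 = c1 ^+ 4 by rewrite -[4%N]/(2 * 2)%N !exprM c2_2 sqrrN.
  rewrite {1}/H (QE4 c1) (QE4 (- c1)) (QE4 c2) (QE4 (- c2)).
  rewrite !(sqrrN, c2_2).
  have odd3 (c : R[i]) : (- c) ^+ 3 = - c ^+ 3 by rewrite !exprS expr0; ring.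
  have even4 (c : R[i]) : (- c) ^+ 4 = c ^+ 4 by rewrite !exprS expr0; ring.
  rewrite !odd3 !even4 c2_3 c2_4 /H !QD !scalerDr !scaleNr.
  have -> : 4%:R *: G = G + G + G + G by rewrite scaler_nat !mulrS addr0 !addrA.
  by zmod.
have nQ x : nrm (Q x) <= u p * nrm x by rewrite mulrC; apply: nrmM.
have nQ4 x : nrm (Q (Q (Q (Q x)))) <= u p ^+ 4 * nrm x.
  rewrite !exprS expr0 mulr1 -!mulrA.
  do 3 (apply: le_trans (nQ _) _; apply: (ler_wpM2l (nrm_ge0 _))).
  exact: nQ.
have s4 : 0 <= s ^+ 4 by rewrite -[4%N]/(2 * 2)%N exprM sqr_ge0.
have H4 : 4 * u p <= nrm H + s ^+ 4 * (u p ^+ 4 * nrm H).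
  have -> : 4 * u p = nrm (4%:R *: G).
    by rewrite -(rmorph_nat (real_complex R)) nrmZr ger0_norm.
  have -> : 4%:R *: G = H - c1 ^+ 4 *: Q (Q (Q (Q H))) by rewrite {1}HE addrK.
  apply: le_trans (nrmB _ _) _; rewrite lerD2l.
  rewrite -rmorphXn nrmZr ger0_norm //; exact: ler_wpM2l.
apply: le_trans H4 _; rewrite mulrA -[X in X + _]mul1r -mulrDl mulrC.
apply: ler_wpM2r; first by rewrite addr_ge0 // mulr_ge0 // exprn_ge0 // nrm_ge0.
rewrite /H; have := nrmD (g (p + c1) + g (p - c1) + g (p + c2)) (g (p - c2)).
have := nrmD (g (p + c1) + g (p - c1)) (g (p + c2)).
have := nrmD (g (p + c1)) (g (p - c1)); lra.
Qed.

Lemma resolvent_lip_le (l m : R[i]) : cabs (m - l) * u l <= 1 / 2 -> u m <= 2 * u l.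
Proof.
move=> h; have e : g m = g l + (m - l) *: (g m ** g l).
  by rewrite -resolvent_eq; zmod.
have := nrmD (g l) ((m - l) *: (g m ** g l)); rewrite -e nrmZ.
have h2 : cabs (m - l) * nrm (g m ** g l) <= 1 / 2 * u m.
  apply: le_trans (ler_wpM2l (cabs_ge0 _) (nrmM _ _)) _.
  rewrite [u m * _]mulrC mulrA; apply: ler_wpM2r h; exact: nrm_ge0.
lra.
Qed.

Lemma resolvent_cont (l : R[i]) (eps : R) : 0 < eps -> exists2 del : R, 0 < del &
  forall m, cabs (m - l) < del -> `|u l - u m| < eps.
Proof.
move=> e0; have U0 := resolvent_gt0 l; have U2 : 0 < 2 * u l ^+ 2 by rewrite mulr_gt0 ?exprn_gt0.
exists (Num.min (1 / 2 / u l) (eps / (2 * u l ^+ 2))).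
  by rewrite lt_min !divr_gt0.
move=> m; rewrite lt_min !ltr_pdivlMr // => /andP[h1 h2].
have um : u m <= 2 * u l by apply: resolvent_lip_le; move: h1; set t := _ * u l; lra.
have d : nrm (g m - g l) < eps.
  rewrite resolvent_eq nrmZ; apply: le_lt_trans h2; apply: (ler_wpM2l (cabs_ge0 _)).
  by apply: le_trans (nrmM _ _) _; rewrite expr2 mulrA; apply: ler_wpM2r um; apply: ltW.
have := nrm_le_dist (g l) (g m); have := nrm_le_dist (g m) (g l); rewrite (nrmBC (g l)).
by rewrite real_ltr_norml ?num_real //; move: d; set t := nrm (_ - _); lra.
Qed.

(** Maximize [u l + eta |l|^2] over a square. Decay of the resolvent excludes a boundary maximum,
    and [resolvent_mean] on a small circle excludes an interior one. *)
Lemma resolvent_not_entire : False.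
Proof.
have u0 := resolvent_gt0 0; have nf := nrm_gt0 f0.
(* With this radius, [resolvent_decay] gives [4 * u l <= u 0] as soon as [|l| >= rho]. *)
pose rho : R := nrm z + 4 * nrm f / u 0.
have k0 : 0 < 4 * nrm f / u 0 by rewrite divr_gt0 // mulr_gt0.
have rho0 : 0 < rho by rewrite /rho ltr_wpDl // nrm_ge0.
have far l : rho <= cabs l -> 4 * u l <= u 0.
  move=> hl; have ul := resolvent_gt0 l.
  have := ler_wpM2l (ltW ul) hl; have := resolvent_decay l => h1 h2.
  have : u l * (4 * nrm f / u 0) <= nrm f by move: h2; rewrite /rho mulrDr; lra.
  rewrite !mulrA ler_pdivrMr // => h3.
  by rewrite -(ler_pM2l nf); move: h3; lra.
(* Chosen so that the quadratic term is at most [u 0 / 4] on the whole square. *)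
pose eta := u 0 / (8 * rho ^+ 2).
have eta0 : 0 < eta by rewrite divr_gt0 // mulr_gt0 // exprn_gt0.
pose F (q : R * R) := u (q.1 +i* q.2) + eta * (q.1 * q.1 + q.2 * q.2).
have cF : continuous F.
  move=> q; apply: cvgD.
    apply/cvgrPdist_lt => eps e0; have [del d0 hd] := resolvent_cont (q.1 +i* q.2) e0.
    exists (ball q.1 (del / 2), ball q.2 (del / 2)).
      by split; apply: nbhsx_ballx; rewrite divr_gt0.
    move=> t [] /=; rewrite -ball_normE /= => h1 h2; apply: hd.
    apply: le_lt_trans (cabs_le_ReIm _) _ => /=.
    by rewrite [X in X + _]distrC [X in _ + X]distrC; lra.
  apply: cvgM; first exact: cvg_cst.
  by apply: cvgD; apply: cvgM; (exact: cvg_fst || exact: cvg_snd).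
pose A := (`[- rho, rho]%classic `*` `[- rho, rho]%classic)%classic.
have [||[a b]] := @compact_EVT_max _ R F A _ _ (continuous_subspaceT cF).
- by exists (0, 0); split => /=; rewrite in_itv /= oppr_le0 ltW.
- by apply: compact_setX; exact: segment_compact.
rewrite inE /A /= !in_itv /= => -[/andP[a1 a2] /andP[b1 b2]] Fmax.
have {}Fmax (c d : R) : - rho <= c <= rho -> - rho <= d <= rho -> F (c, d) <= F (a, b).
  by move=> hc hd; apply: Fmax; rewrite inE /A /= !in_itv.
pose p := a +i* b; pose U := u p.
have [inside|outside] := pselect ((- rho < a < rho) /\ (- rho < b < rho)); last first.
  have hp : rho <= cabs p.
    have [|ap] := leP rho `|a|; first by move=> /le_trans; apply; apply: (cabs_ge_Re p).
    have [|bp] := leP rho `|b|; first by move=> /le_trans; apply; apply: (cabs_ge_Im p).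
    by case: outside; rewrite -!ltr_norml.
  have := Fmax 0 0; rewrite oppr_le0 ltW // => /(_ isT isT).
  rewrite /F /= -/p -[0 +i* 0]/(0 : R[i]) mulr0 addr0 mulr0 addr0 => h.
  have ea : eta * (a * a + b * b) <= u 0 / 4.
    have -> : u 0 / 4 = eta * (2 * rho ^+ 2) by rewrite /eta; field; rewrite gt_eqF.
    by rewrite ler_pM2l //; nra.
  by have := far _ hp; lra.
have U0 : 0 < U := resolvent_gt0 p.
(* The step [s] keeps the four points in the square and makes the gain [eta s^2] exceed the error
   [s^4 U^5] of the mean inequality. *)
have [s [s0 sa sb sU]] : exists s : R, [/\ 0 < s, (- rho <= a - s) && (a + s <= rho),
    (- rho <= b - s) && (b + s <= rho) & s ^+ 2 * U ^+ 5 < eta].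
  move: inside => [/andP[ia1 ia2] /andP[ib1 ib2]].
  pose s := Num.min (Num.min (Num.min (a + rho) (rho - a)) (Num.min (b + rho) (rho - b)))
                    (Num.min 1 (eta / (U ^+ 5 + 1))).
  have U5 : 0 < U ^+ 5 by rewrite exprn_gt0.
  have s0 : 0 < s.
    by rewrite !lt_min divr_gt0 ?ltr01 //=; [rewrite !andbT; lra|lra].
  have : s <= s by []; rewrite {2}/s !le_min ler_pdivlMr; last by lra.
  move=> /andP[/andP[/andP[s1 s2] /andP[s3 s4]] /andP[s5 s6]].
  exists s; split=> //; [lra|lra|].
  have : s ^+ 2 * U ^+ 5 <= s * U ^+ 5.
    by apply: (ler_wpM2r (ltW U5)); rewrite expr2; nra.
  lra.
have mean := resolvent_mean p s.
have e1 : u (p + s%:C) + eta * ((a + s) * (a + s) + b * b) <= F (a, b).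
  have -> : p + s%:C = (a + s) +i* b by rewrite /p; simpc.
  by apply: (Fmax (a + s) b); lra.
have e2 : u (p - s%:C) + eta * ((a - s) * (a - s) + b * b) <= F (a, b).
  have -> : p - s%:C = (a - s) +i* b by rewrite /p; simpc.
  by apply: (Fmax (a - s) b); lra.
have e3 : u (p + 'i * s%:C) + eta * (a * a + (b + s) * (b + s)) <= F (a, b).
  have -> : p + 'i * s%:C = a +i* (b + s) by rewrite /p; simpc.
  by apply: (Fmax a (b + s)); lra.
have e4 : u (p - 'i * s%:C) + eta * (a * a + (b - s) * (b - s)) <= F (a, b).
  have -> : p - 'i * s%:C = a +i* (b - s) by rewrite /p; simpc.
  by apply: (Fmax a (b - s)); lra.
move: mean; set sum := (_ + _ + _ + _); rewrite -/U => mean.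
have : sum <= 4 * U - 4 * (eta * s ^+ 2).
  by move: e1 e2 e3 e4; rewrite /F /= -/p -/U /sum; lra.
have U4 : 0 < 1 + s ^+ 4 * U ^+ 4 by rewrite ltr_wpDr // mulr_ge0 // ltW // exprn_gt0.
move=> /(ler_wpM2r (ltW U4)) h; have := le_trans mean h.
have hU : s ^+ 2 * (s ^+ 2 * U ^+ 5) < s ^+ 2 * eta by rewrite ltr_pM2l ?exprn_gt0 //.
have : 0 < eta * s ^+ 2 * (s ^+ 4 * U ^+ 4).
  exact: mulr_gt0 (mulr_gt0 eta0 (exprn_gt0 2 s0)) (mulr_gt0 (exprn_gt0 4 s0) (exprn_gt0 4 U0)).
by move: hU; lra.
Qed.

End GelfandMazur.

(** * The commutative subalgebra [eV] and quasi-inverses in it *)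

Section RightIdentity.
Variable e : V.
Hypothesis mule1 : forall a, a ** e = a.
Hypothesis comm_mod : forall x a b, x ** (a ** b) = x ** (b ** a).

Lemma mul_e a x : a ** (e ** x) = a ** x.
Proof. by rewrite mulA mule1. Qed.

(* [B] is the commutative closed subalgebra [eV], isomorphic to [V / rad V]. *)
Local Notation B x := (e ** x = x).

Lemma B_e x : B (e ** x). Proof. by rewrite mul_e. Qed.

Lemma B_mul a x : B a -> B (a ** x). Proof. by rewrite mulA => ->. Qed.

Lemma B_add x y : B x -> B y -> B (x + y). Proof. by rewrite mulD => -> ->. Qed.

Lemma B_opp x : B x -> B (- x). Proof. by rewrite mulN => ->. Qed.

Lemma B_sub x y : B x -> B y -> B (x - y).
Proof. by move=> Bx By; apply/B_add/B_opp. Qed.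

Lemma B_scale l x : B x -> B (l *: x). Proof. by rewrite mulZ => ->. Qed.

Lemma commB a b : B a -> B b -> a ** b = b ** a.
Proof. by move=> Ba Bb; rewrite -{1}Ba -{2}Bb -!mulA comm_mod. Qed.

Lemma commBl a b x : B a -> B b -> a ** (b ** x) = b ** (a ** x).
Proof. by move=> Ba Bb; rewrite !mulA (commB Ba Bb). Qed.

(* The quasi-product of [y] and [- w] is [y - w + y ** w]. *)
Lemma quasi_invertible_factor y w : B y -> B w ->
  nrm (y - w + y ** w) <= 1 / 2 -> quasi_invertible mul y.
Proof.
move=> By Bw /quasi_invertible_small[r' [h _]].
set r := _ + _ ** w in h.
have Br : B r by apply: B_add; [exact: B_sub|exact: B_mul].
have r'E : r' = r ** r' - r by apply/eqP; rewrite -subr_eq0 -h; apply/eqP; zmod.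
have Br' : B r' by rewrite r'E; apply: B_sub => //; apply: B_mul.
have By' : B (r' - w + w ** r') by apply: B_add; [exact: B_sub|exact: B_mul].
(* From [(1 - y) (1 + w) = 1 - r], the inverse of [1 - y] is [(1 + w) (1 - r')]. *)
exists (r' - w + w ** r'); rewrite -(commB By By'); split; rewrite -h /r;
  by rewrite !mulBE !mulA; zmod.
Qed.

(** Since [x e = x], this is Jacobson's passage from [1 - e x] to [1 - x e], whose inverse is
    [1 + x (1 - e x)^(-1) e]. *)
Lemma quasi_invertible_e x : quasi_invertible mul (e ** x) -> quasi_invertible mul x.
Proof.
move=> [y [h1 h2]]; exists (x ** y - x).
have e1 : x ** x + x ** y - x ** x ** y = 0.
  by have := congr1 (mul x) h1; rewrite mul0 !mulBE !mulA mule1.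
have e2 : x ** x + x ** y - x ** y ** x = 0.
  by have := congr1 (mul x) h2; rewrite mul0 !mulBE !mulA !mule1.
by rewrite !mulBE !mulA; split; [rewrite -e1|rewrite -e2]; zmod.
Qed.

Lemma jacobson_radB a :
  (forall b, B b -> quasi_invertible mul (b ** a)) -> jacobson_rad mul a.
Proof.
by move=> h b; apply: quasi_invertible_e; rewrite mulA; apply/h/B_e.
Qed.

(* [D] stands for [e d], where [d] is a derivation of the whole algebra. *)
Section Derivation.
Variable D : V -> V.
Hypothesis Dlin : is_linear_map D.
Hypothesis BD : forall x, B (D x).
Hypothesis DM : forall x y, D (x ** y) = D x ** y + e ** x ** D y.
Local Notation S := (separating_space D).

Lemma DMB a y : B a -> D (a ** y) = D a ** y + a ** D y.
Proof. by move=> Ba; rewrite DM Ba. Qed.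

Lemma sepB_B s : S s -> B s.
Proof.
move=> Ss; apply/eqP; rewrite -subr_eq0; apply/eqP/nrm_small => eps e0.
have c0 : 0 < nrm e + 1 by rewrite ltr_wpDl ?nrm_ge0.
have [x [_ hx]] := Ss _ (divr_gt0 e0 c0).
have -> : e ** s - s = (D x - s) - e ** (D x - s).
  by rewrite !mulBE BD; zmod.
have := nrmB (D x - s) (e ** (D x - s)); have := nrmM e (D x - s).
by move: hx; rewrite ltr_pdivlMr //; lra.
Qed.

(** If [x] is near 0 and [D x] near [s], then [D (b x) = D b x + b D x] is near [b s]. *)
Lemma sep_mul b s : B b -> S s -> S (b ** s).
Proof.
move=> Bb Ss eps e0; set K := nrm (D b) + nrm b + 1.
have n1 := nrm_ge0 (D b); have n2 := nrm_ge0 b.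
have c0 : 0 < K by rewrite /K; lra.
have [x [hx hDx]] := Ss _ (divr_gt0 (divr_gt0 e0 (ltr0Sn R 1)) c0).
move: hx hDx; rewrite !ltr_pdivlMr //; set t := nrm x; set t' := nrm (D x - s) => hx hDx.
have p1 : 0 <= nrm (D b) * t by rewrite mulr_ge0 ?nrm_ge0.
have p2 : 0 <= nrm b * t' by rewrite mulr_ge0 ?nrm_ge0.
have p3 : 0 <= nrm b * t by rewrite mulr_ge0 ?nrm_ge0.
have p4 : 0 <= nrm (D b) * t' by rewrite mulr_ge0 ?nrm_ge0.
have q1 : 0 <= t by apply: nrm_ge0.
have q2 : 0 <= t' by apply: nrm_ge0.
exists (b ** x); rewrite DMB //.
have -> : D b ** x + b ** D x - b ** s = D b ** x + b ** (D x - s).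
  by rewrite !mulBE; zmod.
have := nrmD (D b ** x) (b ** (D x - s)); have := nrmM b x.
have := nrmM (D b) x; have := nrmM b (D x - s); rewrite -/t -/t' => h1 h2 h3 h4.
by split; move: hx hDx; rewrite /K; lra.
Qed.

(** * Gliding hump argument on the ideals [a S] *)

Definition sep_nonzero a := B a /\ exists2 s, S s & a ** s <> 0.

Lemma D_bounded_mod a : B a ->
  exists C : R, forall x, exists2 s, S s & nrm (D (a ** x) - a ** s) <= C * nrm x.
Proof.
move=> Ba; have [C C0 hC] := closed_graph_mod_sep Dlin.
exists (nrm (D a) + nrm a * C) => x; have [s Ss hs] := hC x; exists s => //.
have -> : D (a ** x) - a ** s = D a ** x + a ** (D x - s).
  by rewrite DMB // !mulBE; zmod.
have := nrmD (D a ** x) (a ** (D x - s)); have := nrmM (D a) x.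
have := nrmM_le (lexx (nrm a)) hs; lra.
Qed.

(** A tiny [x1] with [D x1] near [s0] puts [D (a x1)] within [eta / 2] of [a s0], hence at least
    [eta / 2] away from [c S]. As [c S] is stable under scaling, stretching by [t] reaches [M]. *)
Lemma D_unbounded_mod a c s0 (eta M del : R) : B a -> S s0 -> 0 < eta -> 0 < M -> 0 < del ->
  (forall s, S s -> eta <= nrm (a ** s0 - c ** s)) ->
  exists2 x, nrm x <= del & forall s, S s -> M <= nrm (D (a ** x) - c ** s).
Proof.
move=> Ba Ss0 eta0 M0 del0 far.
pose K := nrm (D a) + nrm a + 1; have nDa := nrm_ge0 (D a); have na := nrm_ge0 a.
have K0 : 0 < K by rewrite /K; lra.
pose t := 2 * M / eta; have t0 : 0 < t by rewrite divr_gt0 // mulr_gt0.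
have tE : M = t * (eta / 2) by rewrite /t; field; rewrite gt_eqF.
clearbody t.
pose eps := Num.min (eta / 4 / K) (del / t).
have eps0 : 0 < eps by rewrite lt_min (divr_gt0 del0 t0) !divr_gt0.
have [x1 []] := Ss0 _ eps0; rewrite !lt_min !ltr_pdivlMr // => /andP[k1 d1] /andP[k2 _].
exists (t%:C *: x1); first by rewrite nrmZr gtr0_norm // mulrC ltW.
move=> s Ss; have tC : t%:C != 0 :> R[i] by rewrite -(rmorph0 (real_complex R)) (inj_eq (@complexI R)) gt_eqF.
have -> : D (a ** (t%:C *: x1)) - c ** s = t%:C *: (D (a ** x1) - c ** (t%:C^-1 *: s)).
  by rewrite mulZ linZ // scalerBr mulZ scalerA mulfV // scale1r.
have {Ss} := far _ (sepZ Dlin (t%:C^-1) Ss); set s' := _ *: s => hfar.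
have E : D (a ** x1) - c ** s' = (a ** s0 - c ** s') + (D a ** x1 + a ** (D x1 - s0)).
  by rewrite DMB // !mulBE; zmod.
rewrite nrmZr gtr0_norm //.
have q1 := nrm_ge0 x1; have q2 := nrm_ge0 (D x1 - s0).
have h : eta / 2 <= nrm (D (a ** x1) - c ** s').
  have := nrm_le_dist (D (a ** x1) - c ** s') (a ** s0 - c ** s').
  rewrite {2}E opprD addNKr nrmN => h1.
  have := nrmD (D a ** x1) (a ** (D x1 - s0)); have := nrmM (D a) x1.
  have := nrmM a (D x1 - s0).
  have p1 := mulr_ge0 na q1; have p2 := mulr_ge0 nDa q2.
  by move: h1 k1 k2 hfar; rewrite /K; lra.
rewrite tE; exact: ler_wpM2l (ltW t0) _ _ h.
Qed.

Local Notation dense_in a c :=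
  (forall s, S s -> forall eps : R, 0 < eps ->
     exists2 s', S s' & nrm (a ** s - c ** s') < eps).

Lemma not_dense_step a c : ~ dense_in a c ->
  exists2 s0, S s0 & exists2 eta : R, 0 < eta &
    forall s, S s -> eta <= nrm (a ** s0 - c ** s).
Proof.
move=> nd; apply: contrapT => h; apply: nd => s Ss eps eps0.
apply: contrapT => h'; apply: h; exists s => //; exists eps => // s' Ss'.
by rewrite leNgt; apply/negP => lt; apply: h'; exists s'.
Qed.

(* The lower bound on [D (a x)] modulo [b a S] beats both the previous partial
   sum [p] and the tail, which lies in [b a V] and is bounded modulo [b a S]. *)
Lemma hump_step (n : nat) (a p : V) :
  (forall a, sep_nonzero a -> exists b,
     [/\ B b, sep_nonzero (b ** a) & ~ dense_in a (b ** a)]) ->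
  sep_nonzero a -> exists b x,
    [/\ B b, nrm b <= 1, sep_nonzero (b ** a), nrm x <= 1 / 2 / 2 ^+ n &
        exists2 C : R,
          forall y, exists2 s, S s & nrm (D (b ** a ** y) - b ** a ** s) <= C * nrm y &
          0 <= C /\ forall s, S s -> n%:R + C + nrm (D p) <= nrm (D (a ** x) - b ** a ** s)].
Proof.
move=> unstable sa; have [Ba _] := sa.
have [b [Bb [Bba [s1 Ss1 s1_neq0]] /not_dense_step[s0 Ss0 [eta eta0 far]]]] := unstable _ sa.
(* Scaling brings [b] into the unit ball without changing [b a S]. *)
pose t := (1 + nrm b)^-1; have nb := nrm_ge0 b.
have t0 : 0 < t by rewrite invr_gt0 ltr_wpDr.
have tC : t%:C != 0 :> R[i].
  by rewrite -(rmorph0 (real_complex R)) (inj_eq (@complexI R)) gt_eqF.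
pose b' := t%:C *: b; have Bb' : B b' by apply: B_scale.
have b'E s : b' ** a ** s = b ** a ** (t%:C *: s) by rewrite !mulZl mulZ.
have sb' : sep_nonzero (b' ** a).
  split; first exact: B_mul.
  exists s1 => //; rewrite !mulZl => /eqP; rewrite scaler_eq0 (negPf tC) /=.
  by move/eqP.
have [C0 hC0] := D_bounded_mod (proj1 sb').
pose C := Num.max C0 0.
have [|||x hx1 hx2] := @D_unbounded_mod a (b' ** a) s0 eta (n%:R + C + nrm (D p) + 1)
   (1 / 2 / 2 ^+ n) Ba Ss0 eta0 _ _ _.
- by rewrite ltr_wpDl // !addr_ge0 ?nrm_ge0 // le_max lexx orbT.
- by rewrite !divr_gt0 // exprn_gt0.
- by move=> s Ss; rewrite b'E; apply/far/(sepZ Dlin).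
exists b', x; split=> //.
  rewrite nrmZr gtr0_norm // /t mulrC ler_pdivrMr ?ltr_wpDr //; lra.
exists C.
  move=> y; have [s Ss hs] := hC0 y; exists s => //; apply: le_trans hs _.
  by apply: ler_wpM2r; [exact: nrm_ge0|rewrite le_max lexx].
split; first by rewrite le_max lexx orbT.
by move=> s /hx2; apply: le_trans; lra.
Qed.

(** Otherwise [hump_step] iterates, giving [a_(n+1) = b_n a_n] and a vector [w], the sum of the
    [a_n x_n], with [nrm (D w) >= n] for every [n]. *)
Lemma separating_space_stable :
  (exists2 s, S s & s <> 0) -> exists2 a, sep_nonzero a &
    forall b, B b -> sep_nonzero (b ** a) -> dense_in a (b ** a).
Proof.
move=> [s1 Ss1 s1_neq0]; apply: contrapT => nostable.
have unstable a : sep_nonzero a -> exists b,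
    [/\ B b, sep_nonzero (b ** a) & ~ dense_in a (b ** a)].
  move=> sa; apply: contrapT => h; apply: nostable; exists a => // b Bb sba.
  by apply: contrapT => nd; apply: h; exists b.
have step : forall q : nat * (V * V), exists r : V * V, sep_nonzero q.2.1 ->
   let: (n, (a, p)) := q in let: (b, x) := r in
    [/\ B b, nrm b <= 1, sep_nonzero (b ** a), nrm x <= 1 / 2 / 2 ^+ n &
        exists2 C : R,
          forall y, exists2 s, S s & nrm (D (b ** a ** y) - b ** a ** s) <= C * nrm y &
          0 <= C /\ forall s, S s -> n%:R + C + nrm (D p) <= nrm (D (a ** x) - b ** a ** s)].
  move=> [n [a p]] /=; have [sa|] := pselect (sep_nonzero a); last by exists (0, 0).
  by have [b [x h]] := @hump_step n a p unstable sa; exists (b, x).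
have [f hf] := choice step.
pose st := fix st n := if n is n'.+1 then
   let: (a, p) := st n' in let: (b, x) := f (n', st n') in (b ** a, p + a ** x)
   else (e, 0).
pose a n := (st n).1; pose p n := (st n).2.
pose b n := (f (n, st n)).1; pose x n := (f (n, st n)).2.
have aS n : a n.+1 = b n ** a n by rewrite /a /b /=; case: (st n) => ? ?; case: (f _).
have pS n : p n.+1 = p n + a n ** x n.
  by rewrite /p /a /x /=; case: (st n) => ? ?; case: (f _).
have san n : sep_nonzero (a n).
  elim: n => [|n IH].
    by split; [exact: mule1|exists s1 => //; rewrite (sepB_B Ss1)].
  have := hf (n, st n) IH; rewrite aS /b.
  by rewrite -/(a n) /a; case: (st n) => a' p'; case: (f _) => b' x' /= [].
have P n : [/\ B (b n), nrm (b n) <= 1, nrm (x n) <= 1 / 2 / 2 ^+ n &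
        exists2 C : R,
          forall y, exists2 s, S s & nrm (D (a n.+1 ** y) - a n.+1 ** s) <= C * nrm y &
          0 <= C /\ forall s, S s -> n%:R + C + nrm (D (p n)) <= nrm (D (a n ** x n) - a n.+1 ** s)].
  have := hf (n, st n) (san n); rewrite aS /b /p /x /a.
  by case: (st n) => a' p'; case: (f _) => b' x' /= [].
(* Truncations of [x_n + b_n x_(n+1) + b_n b_(n+1) x_(n+2) + ...]; their limits satisfy
   [y n = x n + b n ** y n.+1]. *)
pose Y := fix Y m n := if m is m'.+1 then x n + b n ** Y m' n.+1 else 0.
have Ystep n m : nrm (Y m.+1 n - Y m n) <= 1 / 2 / 2 ^+ n / 2 ^+ m.
  elim: m n => [|m IH] n.
    by rewrite /= mul0 addr0 subr0 expr0 divr1; have [] := P n.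
  have -> : Y m.+2 n - Y m.+1 n = b n ** (Y m.+1 n.+1 - Y m n.+1).
    by rewrite /= !mulBE; zmod.
  have [_ hb _ _] := P n; apply: le_trans (nrmM_le hb (IH n.+1)) _.
  by rewrite !exprS !invfM; lra.
have limY n : exists y, forall m, nrm (y - Y m n) <= 2 * (1 / 2 / 2 ^+ n) / 2 ^+ m.
  by apply: geometric_cvg => m; apply: Ystep.
have [y hy] := choice limY.
have pow_le1 n : (2 ^+ n : R)^-1 <= 1 by rewrite invf_le1 ?exprn_gt0 // exprn_ege1 // ler1n.
have pow_ge0 n : 0 <= (2 ^+ n : R)^-1 by rewrite invr_ge0 exprn_ge0.
have y_le1 n : nrm (y n) <= 1.
  have := hy n 0%N; rewrite subr0 expr0 divr1; have := pow_le1 n; lra.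
have yE n : y n = x n + b n ** y n.+1.
  apply/eqP; rewrite -subr_eq0; apply/eqP/(@nrm_pow_small _ 2) => m.
  have -> : y n - (x n + b n ** y n.+1) = (y n - Y m.+1 n) - b n ** (y n.+1 - Y m n.+1).
    by rewrite /= !mulBE; zmod.
  have [_ hb _ _] := P n; have := nrmM_le hb (hy n.+1 m).
  have := nrmB (y n - Y m.+1 n) (b n ** (y n.+1 - Y m n.+1)).
  have := hy n m.+1; rewrite !exprS !invfM.
  have := mulr_ge0 (pow_ge0 n) (pow_ge0 m).
  have : (2 ^+ n)^-1 * (2 ^+ m)^-1 <= (2 ^+ m : R)^-1 by rewrite ler_piMl.
  lra.
have sumE n : e ** y 0%N = p n + a n ** y n.
  elim: n => [|n IH]; first by rewrite add0r.
  have [Bb _ _ _] := P n; have [Ba _] := san n.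
  by rewrite IH pS aS yE mulD mulA (commB Ba Bb) addrA.
(* For every [n], [w] is the partial sum, the hump [a n ** x n] and a tail [a n.+1 ** y n.+1] with
   [nrm (y n.+1) <= 1]; take [n] above [nrm (D w)]. *)
pose w := e ** y 0%N; pose n := Num.bound (nrm (D w)).
have : nrm (D w) < n%:R by apply/archi_boundP/nrm_ge0.
have [_ _ _ [C hC [C0 hx]]] := P n.
have [s Ss hs] := hC (y n.+1).
have wE : D w = D (p n) + D (a n ** x n) + D (a n.+1 ** y n.+1).
  by rewrite /w (sumE n.+1) pS !(linD Dlin).
have := hx _ (sepN Dlin Ss); rewrite mulN opprK.
have -> : D (a n ** x n) + a n.+1 ** s =
    (D w - D (p n)) - (D (a n.+1 ** y n.+1) - a n.+1 ** s) by rewrite wE; zmod.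
have := nrmB (D w - D (p n)) (D (a n.+1 ** y n.+1) - a n.+1 ** s).
have := nrmB (D w) (D (p n)).
have := le_trans hs (ler_piMr C0 (y_le1 n.+1)); lra.
Qed.


(** * Vanishing of the separating space and continuity of [D] *)

Hypothesis semisimple : forall c, B c -> jacobson_rad mul c -> c = 0.

Lemma separating_space_trivial s : S s -> s = 0.
Proof.
move=> Ss; apply: contrapT => s_neq0.
have [|a [Ba [s2 Ss2 as2]] stable] := separating_space_stable; first by exists s.
have [beta [Bbeta nqi]] : exists beta, B beta /\ ~ quasi_invertible mul (beta ** (a ** s2)).
  apply: contrapT => h; apply/as2/semisimple; first exact: B_mul.
  by apply: jacobson_radB => b Bb; apply: contrapT => nq; apply: h; exists b.
pose s3 := beta ** s2; have Ss3 : S s3 by apply: sep_mul.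
pose f := a ** s3; have Bf : B f by apply: B_mul.
have {}nqi : ~ quasi_invertible mul f by rewrite /f /s3 commBl.
have f0 : f <> 0.
  by move=> f0; apply: nqi; exists 0; rewrite f0 mul0 !addr0 subr0.
(* Otherwise [(e - f) a S] is dense in [a S], so some [(e - f) a s'] approximates [f], which makes
   [f] quasi-invertible. *)
have fas t : S t -> f ** (a ** t) = a ** t.
  move=> St; apply: contrapT => neq.
  have Bef : B (e - f) by apply: B_sub => //; exact: mule1.
  have [|s' Ss' hs'] := stable _ Bef _ _ Ss3 (1 / 2) (divr_gt0 ltr01 (ltr0Sn R 1)).
    split; first exact: B_mul.
    exists t => // h; apply: neq; apply/eqP; rewrite -subr_eq0; apply/eqP.
    by rewrite -[RHS]oppr0 -h !mulBE Ba -!mulA; zmod.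
  apply: nqi; apply: (@quasi_invertible_factor _ (a ** s')) => //; first exact: B_mul.
  by move/ltW: hs'; rewrite -/f !mulBE Ba -!mulA opprB addrA addrAC.
have ff : f ** f = f by apply: fas.
have Sf : S f by apply: sep_mul.
have fB z : f ** z = z -> B z by move=> <-; apply: B_mul.
(* As [b f = b] is nonzero, [b a S] is dense in [a S]; some [b w] is near [f], and a Neumann series
   corrects it to an inverse. *)
have finv b : f ** b = b -> b <> 0 -> exists g, f ** g = g /\ b ** g = f.
  move=> fb b0; have Bb := fB b fb; have bf : b ** f = b by rewrite commB.
  have [|s' Ss' /ltW hs'] := stable b Bb _ _ Ss3 (1 / 2) (divr_gt0 ltr01 (ltr0Sn R 1)).
    by split; [exact: B_mul|exists s3; rewrite // -mulA -/f bf].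
  pose w := a ** s'; pose r := f - b ** w.
  have nr : nrm r <= 1 / 2 by rewrite /r /w mulA.
  have fr : f ** r = r by rewrite /r !mulBE mulA ff fb.
  have bwE : b ** w = f - r by rewrite /r; zmod.
  clearbody r; have [r' [hr' _]] := quasi_invertible_small nr.
  have r'E : r' = r ** r' - r by apply/eqP; rewrite -subr_eq0 -hr'; apply/eqP; zmod.
  have fr' : f ** r' = r' by rewrite r'E !mulBE mulA fr.
  have rf : r ** f = r by rewrite commB //; apply: fB.
  exists (f ** (w ** (f - r'))); split; first by rewrite mulA ff.
  rewrite mulA bf mulA bwE !mulBE ff fr' rf -[RHS]addr0 -oppr0 -hr'; zmod.
have scal z : f ** z = z -> exists l : R[i], z = l *: f.
  move=> fz; apply: contrapT => nz; have zf : z ** f = z by rewrite commB //; apply: fB.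
  have ginv l : exists g, f ** g = g /\ (z - l *: f) ** g = f.
    apply: finv; first by rewrite !mulBE mulZ ff fz.
    by move=> h; apply: nz; exists l; apply/eqP; rewrite -subr_eq0 h.
  have [g hg] := choice ginv.
  have fg l : f ** g l = g l by have [] := hg l.
  have zg l : (z - l *: f) ** g l = f by have [] := hg l.
  have Bg l : B (g l) by apply/fB/fg.
  apply: (@resolvent_not_entire f z g) => // l; first by rewrite commB.
  by rewrite commB //; apply: fB; rewrite !mulBE mulZ ff fz.
(* Idempotency gives [D f = 2 f D f]; multiplying by [f] yields [f D f = 0]. *)
have Df0 : D f = 0.
  have fDf := DMB f Bf; rewrite ff (commB (BD f) Bf) in fDf.
  have := congr1 (mul f) fDf; rewrite mulD mulA ff => /eqP.
  by rewrite -subr_eq0 opprD addrA subrr sub0r oppr_eq0 => /eqP h; rewrite fDf h addr0.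
(* [D (f x)] vanishes because [f x] is a scalar multiple of [f]. *)
have fD x : f ** D x = 0.
  have [|l hl] := scal (f ** x); first by rewrite mulA ff.
  by have := DMB x Bf; rewrite hl (linZ Dlin) Df0 scaler0 mul0l add0r.
(* Since [f] is in [S], some [D x] is within [1 / 2] of it, while [f = f (f - D x)]. *)
apply: f0; apply: nrm_eq0; have [x [_ hx]] := Sf (1 / 2) (divr_gt0 ltr01 (ltr0Sn R 1)).
have E : f = f ** (f - D x) by rewrite mulD mulN fD ff subr0.
have := nrmM f (f - D x); rewrite -E nrmBC; have := nrm_ge0 f.
move: hx; set t := nrm (_ - _); set u := nrm f => hx u0 h.
by apply/eqP; rewrite eq_le u0 andbT; nra.
Qed.

Lemma D_bounded : exists2 C : R, 0 <= C & forall x, nrm (D x) <= C * nrm x.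
Proof.
have [C C0 hC] := closed_graph_mod_sep Dlin; exists C => // x.
by have [s /separating_space_trivial->] := hC x; rewrite subr0.
Qed.

(** * The Kleinecke-Shirokov argument *)

Section Kleinecke.
Variables a beta : V.
Hypotheses (Ba : B a) (Bbeta : B beta).

Let E x := beta ** D x.
Let c := E a.
Let ad (X : V -> V) x := a ** X x - X (a ** x).

(** [ad] is the commutator with left multiplication by [a], a derivation for composition. It sends
    [E] to left multiplication by [- c], which it then kills as [a] and [c] commute, so Leibniz'
    formula has two terms. *)
Lemma ad_comp X j x :
  iter j.+1 ad (E \o X) x = E (iter j.+1 ad X x) - (c ** iter j ad X x) *+ j.+1.
Proof.
have Bc : B c by apply: B_mul.
have aE y : a ** E y = E (a ** y) - c ** y.
  by rewrite /E DMB // mulD !mulA (commB Ba Bbeta); zmod.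
have EB y z : E (y - z) = E y - E z by rewrite /E (linB Dlin) !mulBE.
elim: j x => [|j IH] x; first by rewrite /= /ad aE /= EB mulr1n; zmod.
rewrite -[LHS]/(a ** iter j.+1 ad (E \o X) x - iter j.+1 ad (E \o X) (a ** x)) !IH.
rewrite -[iter j.+2 ad X x]/(a ** iter j.+1 ad X x - iter j.+1 ad X (a ** x)) EB.
have Z'E : iter j.+1 ad X x = a ** iter j ad X x - iter j ad X (a ** x) by [].
move: Z'E; set Z := iter j ad X; set Z' := iter j.+1 ad X => Z'E.
have qE : c ** Z' x = a ** (c ** Z x) - c ** Z (a ** x).
  by rewrite Z'E !mulBE (commBl _ Ba Bc).
have mulMn y n : a ** (y *+ n) = (a ** y) *+ n.
  by elim: n => [|n IHn]; rewrite ?mulr0n ?mul0 // !mulrS mulD IHn.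
have -> : a ** (E (Z' x) - c ** Z x *+ j.+1) - (E (Z' (a ** x)) - c ** Z (a ** x) *+ j.+1)
    = a ** E (Z' x) - E (Z' (a ** x)) - (c ** Z' x) *+ j.+1.
  by rewrite qE mulrnBl mulD mulN mulMn; zmod.
by rewrite aE [in RHS]mulrS; zmod.
Qed.

Lemma ad_iter_self n x :
  iter n ad (iter n E) x = ((-1) ^+ n * n`!%:R) *: iter n (mul c) x.
Proof.
have Bc : B c by apply: B_mul.
have cZ n0 y : c ** iter n0 (mul c) y = iter n0.+1 (mul c) y by [].
have ca n0 y : iter n0 (mul c) (a ** y) = a ** iter n0 (mul c) y.
  by elim: n0 => [|n0 IH] //=; rewrite IH commBl.
elim: n x => [|n IH] x; first by rewrite /= mulr1 scale1r.
(* By induction [ad^n (E^n)] is a multiple of a power of [c], hence commutes with [a]. *)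
have top : iter n.+1 ad (iter n E) x = 0.
  by rewrite /= /ad !IH ca mulZ subrr.
have -> : iter n.+1 E = E \o iter n E by [].
rewrite ad_comp top IH /E (lin0 Dlin) mul0 sub0r mulZ cZ -scaler_nat scalerA -scaleNr.
by congr (_ *: _); rewrite factS natrM exprS; ring.
Qed.

(** [ad] multiplies operator bounds by at most [2 * nrm a]; this is compared with the exact value
    from [ad_iter_self]. *)
Lemma pow_bound : exists L : R, 0 <= L /\
  forall n, n`!%:R * nrm (iter n (mul c) e) <= L ^+ n * nrm e.
Proof.
have [C C0 hC] := D_bounded.
pose K := nrm beta * C; have K0 : 0 <= K by rewrite mulr_ge0 ?nrm_ge0.
have na := nrm_ge0 a.
have hE n x : nrm (iter n E x) <= K ^+ n * nrm x.
  elim: n => [|n IH] /=; first by rewrite mul1r.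
  apply: le_trans (nrmM _ _) _; rewrite exprS /K -!mulrA.
  apply: (ler_wpM2l (nrm_ge0 _)); apply: le_trans (hC _) _.
  by apply: (ler_wpM2l C0); rewrite /K in IH; apply: le_trans IH _; rewrite -?mulrA.
have had (X : V -> V) (M : R) : 0 <= M -> (forall x, nrm (X x) <= M * nrm x) ->
    forall n x, nrm (iter n ad X x) <= (2 * nrm a) ^+ n * M * nrm x.
  move=> M0 hX; elim=> [|n IH] x /=; first by rewrite expr0 mul1r.
  set N := (2 * nrm a) ^+ n * M in IH *.
  have N0 : 0 <= N by rewrite mulr_ge0 // exprn_ge0 // mulr_ge0.
  have h1 := nrmM_le (lexx (nrm a)) (IH x).
  have h2 := le_trans (IH (a ** x)) (ler_wpM2l N0 (nrmM a x)).
  have := nrmB (a ** iter n ad X x) (iter n ad X (a ** x)).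
  by rewrite exprS -[2 * nrm a * _ * M]mulrA -/N /ad; lra.
exists (2 * nrm a * K); split=> [|n]; first by apply: mulr_ge0 K0; apply: mulr_ge0.
have := had _ _ (exprn_ge0 n K0) (hE n) n e.
rewrite ad_iter_self nrmZ normrM normrX normrN1 expr1n mul1r normr_nat.
have -> : complex.Re (n`!%:R : R[i]) = n`!%:R by rewrite -(rmorph_nat (real_complex R)).
by rewrite (exprMn n (2 * nrm a)).
Qed.

(** The approximate inverse [w n = c + ... + c ^ n] leaves the error [c ^ (n + 1)], which
    [pow_bound] and [factorial_dominates] bring below [1 / 2]. *)
Lemma quasi_invertible_derivation : quasi_invertible mul c.
Proof.
have [L [L0 hL]] := pow_bound.
have [n hn] := factorial_dominates L0 (nrm_ge0 e).
have Bc : B c by apply: B_mul.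
pose w m := iter m (fun v => c + c ** v) 0.
have Bw m : B (w m) by case: m => [|m] /=; [rewrite mul0|apply: B_add => //; apply: B_mul].
apply: (@quasi_invertible_factor _ (w n)) => //.
have -> : c - w n + c ** w n = iter n.+1 (mul c) e.
  elim: n {hn} => [|n IH]; first by rewrite /= mule1 mul0 subr0 addr0.
  by rewrite iterS -IH /= !mulBE; zmod.
have f0 : 0 < n.+1`!%:R :> R by rewrite ltr0n fact_gt0.
by rewrite -(ler_pM2l f0); have := hL n.+1; move: hn; lra.
Qed.

End Kleinecke.

(** On [B] semisimplicity gives [D a = 0]; then [D e = 0] and [D (e x) = 0] force
    [D x = e (D x) = 0]. *)
Theorem derivation_zero x : D x = 0.
Proof.
have zB a : B a -> D a = 0.
  move=> Ba; apply: semisimple => //; apply: jacobson_radB => b Bb.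
  exact: quasi_invertible_derivation.
by have := zB _ (B_e x); rewrite DMB ?mule1 // zB ?mule1 // mul0l add0r BD.
Qed.

End Derivation.

End RightIdentity.
End BanachAlgebra.

(** * The equivalences for generalized derivations *)

Theorem theorem4p7 (R : realType) (V : completeNormedModType (R[i])%C)
  (mul : V -> V -> V) (delta d : V -> V) (k : nat) :
  banach_algebra mul ->
  jacobson_rad mul = rann mul ->
  quotient_by_rad_commutative mul ->
  has_right_identity mul ->
  is_generalized_derivation mul delta d ->
  (0 < k)%N ->
  [/\ (k_commuting mul delta k <-> k_centralizing mul delta k),
      (k_centralizing mul delta k <-> right_multiplier mul delta) &
      (right_multiplier mul delta <-> exists b : V, delta = Rmul mul b)].
Proof.
move=> bA radE qcomm [e mule1] [delta_lin [d_lin dM] deltaM] _.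
have comm_mod x a b : mul x (mul a b) = mul x (mul b a).
  have := qcomm a b; rewrite radE => /(_ x); rewrite (mulD bA) (mulN bA).
  by move/eqP; rewrite subr_eq0 => /eqP.
have d_rann a x : mul a (d x) = 0.
  suff <- : mul a (mul e (d x)) = 0 by rewrite (mul_e bA mule1).
  have -> : mul e (d x) = 0; last exact: mul0.
  apply: (@derivation_zero R V mul bA e mule1 comm_mod (fun y => mul e (d y))).
  - by move=> l y z; rewrite d_lin (mulD bA) (mulZ bA).
  - by move=> y; rewrite (mul_e bA mule1).
  - by move=> y z; rewrite dM (mulD bA) !(mulA bA) mule1.
  - by move=> c <- ; rewrite radE => /(_ e); rewrite (mul_e bA mule1).
have apow_comm a : mul (apow mul a k) a = mul a (apow mul a k).
  by rewrite /apow; elim: k.-1 => [|m IH] //=; rewrite -(mulA bA) IH.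
(* The leading factor [a] lets [comm_mod] exchange [b] and the power of [a]. *)
have Rmul_commuting b a : commutator mul (mul a b) (apow mul a k) = 0.
  rewrite /commutator -(mulA bA) (comm_mod a) (mulA bA) -apow_comm -(mulA bA).
  by rewrite subrr.
have rmE : right_multiplier mul delta -> delta = Rmul mul (delta e).
  by move=> [_ h]; apply/funext => a; rewrite /Rmul -h mule1.
have comm_centr : k_commuting mul delta k -> k_centralizing mul delta k.
  by move=> h a; rewrite h => x; rewrite (mul0 bA) (mul0l bA).
have rm_comm : right_multiplier mul delta -> k_commuting mul delta k.
  by move=> /rmE-> a; apply: Rmul_commuting.
have deltaE a : delta a = mul a (delta e) + d a.
  by rewrite -{1}(mule1 a) deltaM mule1.
have centr_rm : k_centralizing mul delta k -> right_multiplier mul delta.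
  move=> hc.
  (* Centrality is tested against [e]: multiplying by [e] on the right changes nothing, on the left
     it gives 0. *)
  have da_pow a : mul (d a) (apow mul a k) = 0.
    have := hc a e; rewrite mule1 deltaE.
    have -> : commutator mul (mul a (delta e) + d a) (apow mul a k) =
        commutator mul (mul a (delta e)) (apow mul a k) + mul (d a) (apow mul a k).
      by rewrite /commutator (mulD bA) (mulDl bA) d_rann; zmod.
    by rewrite Rmul_commuting add0r (mulA bA) d_rann (mul0l bA).
  have apow_e : apow mul e k = e.
    by rewrite /apow; elim: k.-1 => [|m IH] //=; rewrite IH mule1.
  have de : d e = 0 by have := da_pow e; rewrite apow_e mule1.
  have d0 a : d a = 0.
    (* [x c = 0] means [t x = - x a], impossible for nonzero [x] as [t > nrm a]; and [d c = d a]
       because [d e = 0]. *)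
    pose t := nrm a + 1; pose c := t%:C *: e + a.
    have mulc_inj x : mul x c = 0 -> x = 0.
      rewrite (mulD bA) (mulZ bA) mule1 => /eqP; rewrite addr_eq0 => /eqP h.
      have := nrmZr t x; rewrite h nrmN ger0_norm ?addr_ge0 ?nrm_ge0 // => h1.
      apply: nrm_eq0; apply/eqP; rewrite eq_le nrm_ge0 andbT.
      by have := nrmM bA x a; rewrite h1 /t; lra.
    have mulc_pow_inj m x : mul x (iter m (mul c) c) = 0 -> x = 0.
      elim: m x => [|m IH] x; first exact: mulc_inj.
      by rewrite /= (mulA bA) => /IH/mulc_inj.
    by have := da_pow c; rewrite d_lin de scaler0 add0r => /mulc_pow_inj.
  by split=> // a b; rewrite deltaM d0 (mul0l bA) addr0.
split; split.
- exact: comm_centr.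
- by move/centr_rm/rm_comm.
- exact: centr_rm.
- by move/rm_comm/comm_centr.
- by move=> /rmE h; exists (delta e).
- by move=> [b ->]; split=> [|x y]; [exact: mulr_lin|rewrite /Rmul (mulA bA)].
Qed.
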